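(* Let $X$ be a Banach space. For every $X$-valued cylindrical function $F\in\mathscr{C}(\Omega;X)$ and every $B\in\mathcal{E}_\mu$, $$\mathbb{E}\int_B DF\,\mathrm{d}\mu=\mathbb{E}\big(\tilde N(B)F\big).$$
   Context: Poisson random measure: $(\Omega,\mathcal{F},\mathbb{P})$ is a probability space, $(E,\mathcal{E})$ a measurable space, and $N$ is a Poisson random measure on $(E,\mathcal{E})$ with $\sigma$-finite intensity measure $\mu$, i.e. a map $N:\Omega\times\mathcal{E}\to\mathbb{N}\cup\{\infty\}$ such that $N(B)$ is a random variable for each $B\in\mathcal{E}$, $N(\omega,\cdot)$ is a measure for each $\omega$, $N(B)$ is Poisson distributed with parameter $\mu(B)$ ($N(B)=\infty$ a.s. if $\mu(B)=\infty$), and $N(B_1),\dots,N(B_n)$ are independent for pairwise disjoint $B_1,\dots,B_n$. Put $\mathcal{E}_\mu=\{B\in\mathcal{E}:\mu(B)<\infty\}$ and $\tilde N(B)=N(B)-\mu(B)$ for $B\in\mathcal{E}_\mu$. Cylindrical functions: a (real) cylindrical function is a random variable $F=f(N(B_1),\dots,N(B_M))$ with $M\ge 1$, $f:\mathbb{N}^M\to\mathbb{R}$ ($0\in\mathbb{N}$) and $B_1,\dots,B_M\in\mathcal{E}_\mu$, which may always be taken pairwise disjoint. $\mathscr{C}(\Omega)$ is the real vector space of these, and $\mathscr{C}(\Omega;X)=\mathscr{C}(\Omega)\otimes X$ consists of all $F=\sum_{i=1}^n F_i\otimes x_i$ with $n\ge1$, $F_i\in\mathscr{C}(\Omega)$,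 $x_i\in X$. Malliavin derivative: writing $F=\sum_{i=1}^n f_i(N(\mathbf{B}))\otimes x_i\in\mathscr{C}(\Omega;X)$ with $N(\mathbf{B})=(N(B_1),\dots,N(B_M))$, $B_1,\dots,B_M\in\mathcal{E}_\mu$ pairwise disjoint, and $\mathbf{e}_m$ the $m$-th unit vector of $\mathbb{R}^M$, $$DF=\sum_{i=1}^n\sum_{m=1}^M\big(f_i(N(\mathbf{B})+\mathbf{e}_m)-f_i(N(\mathbf{B}))\big)\otimes(\mathbf 1_{B_m}\otimes x_i),$$ a random variable with values in $L^2(E,\mu)\otimes X$; it does not depend on the representation of $F$.
   Formalization: Since f is arbitrary, the expectations need not exist; the identity is proved whenever both ∫_B DF dμ and Ñ(B)F are Bochner integrable over Ω, and ∫_B DF dμ is also shown integrable if F and Ñ(B)F are. *)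

(* Defs.v *)
From HB Require Import structures.
From mathcomp Require Import all_boot all_order all_algebra.
From mathcomp Require Import all_classical all_reals all_analysis.
From mathcomp Require Import measurable_realfun.

Set Implicit Arguments.
Unset Strict Implicit.
Unset Printing Implicit Defensive.
Import Order.TTheory GRing.Theory Num.Theory.
Import numFieldNormedType.Exports.
Local Open Scope classical_set_scope.
Local Open Scope ring_scope.

(** ** Bochner integral of functions with values in a normed space *)

Section bochner.
Context {R : realType} {d : measure_display} {T : measurableType d}
  {X : normedModType R}.
Variable mu : {measure set T -> \bar R}.
Implicit Types (s f : T -> X) (v : X).

Definition mu_simple s : Prop :=
  [/\ finite_set (range s),
      forall x : X, measurable (s @^-1` [set x])
    & forall x : X, x != 0 -> (mu (s @^-1` [set x]) < +oo)%E].

(* The fibre over [0] may have infinite measure; its term is [_ *: 0 = 0]. *)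
Definition simple_integral s : X :=
  \sum_(x \in range s) fine (mu (s @^-1` [set x])) *: x.

(* The almost everywhere convergence of the [s n] is the strong measurability
   of [f]; it cannot be dropped, because [\int[mu]] is also defined on
   non-measurable functions. *)
Definition is_bochner_integral f v : Prop :=
  exists s : nat -> T -> X,
    [/\ forall n, mu_simple (s n),
        {ae mu, forall t, (s n t @[n --> \oo] --> f t)},
        (\int[mu]_t (`|f t - s n t|)%:E)%E @[n --> \oo] --> 0%E
      & simple_integral (s n) @[n --> \oo] --> v].

Definition bochner_integrable f : Prop := exists v, is_bochner_integral f v.

(* Only meaningful under [bochner_integrable f]. *)
Definition bochner_integral f : X := xget 0 [set v | is_bochner_integral f v].

End bochner.

(** ** Poisson random measures *)

Section poisson_random_measure.
Context {R : realType} {d d' : measure_display}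
  {Omega : measurableType d} {E : measurableType d'}.
Variable P : probability Omega R.

Definition mutually_independent n (Z : 'I_n -> Omega -> \bar R) : Prop :=
  forall A : 'I_n -> set (\bar R), (forall i, measurable (A i)) ->
    fine (P [set w | forall i, A i (Z i w)]) =
    \prod_(i < n) fine (P [set w | A i (Z i w)]).

(* [N : R.-ker Omega ~> E] already says that each [N w] is a measure and that
   each [N ^~ B] with [B] measurable is a measurable function. *)
Record poisson_random_measure (mu : {measure set E -> \bar R})
    (N : R.-ker Omega ~> E) : Prop := PoissonRandomMeasure {
  prm_integer : forall w B, measurable B ->
    N w B = +oo%E \/ exists k : nat, N w B = (k%:R)%:E ;
  prm_finite : forall B, measurable B -> (mu B < +oo)%E -> forall k : nat,
    P [set w | N w B = (k%:R)%:E] =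
    (expR (- fine (mu B)) * fine (mu B) ^+ k / k`!%:R)%:E ;
  prm_infinite : forall B, measurable B -> mu B = +oo%E ->
    {ae P, forall w, N w B = +oo%E} ;
  prm_independent : forall n (B : 'I_n -> set E),
    (forall i, measurable (B i)) -> trivIset setT B ->
    mutually_independent (fun i w => N w (B i))
}.

End poisson_random_measure.

(** ** Cylindrical functions and the Malliavin derivative *)

Section malliavin.
Context {R : realType} {d d' : measure_display}
  {Omega : measurableType d} {E : measurableType d'}.
Variables (P : probability Omega R) (mu : {measure set E -> \bar R})
  (N : R.-ker Omega ~> E).

Definition finite_measurable (B : set E) : Prop :=
  measurable B /\ (mu B < +oo)%E.

(* If [mu B < +oo], then [N w B = +oo] only for [w] in a null set, on which the
   values of the next two definitions are junk.  This is why random variables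
   are identified below when they agree almost surely. *)
Definition counts M (B : 'I_M -> set E) (w : Omega) : {ffun 'I_M -> nat} :=
  [ffun m => Num.truncn (fine (N w (B m)))].

Definition compensated (B : set E) (w : Omega) : R :=
  fine (N w B) - fine (mu B).

Definition cylindrical (F : Omega -> R) : Prop :=
  exists (M : nat) (f : {ffun 'I_M -> nat} -> R) (B : 'I_M -> set E),
    [/\ (1 <= M)%N, forall m, finite_measurable (B m)
      & {ae P, forall w, F w = f (counts B w)}].

(* Elements of [C(Omega) (x) X] are identified with [X]-valued functions. *)
Definition vector_cylindrical (X : normedModType R) (F : Omega -> X) : Prop :=
  exists (n : nat) (G : 'I_n -> Omega -> R) (x : 'I_n -> X),
    [/\ (1 <= n)%N, forall i, cylindrical (G i)
      & {ae P, forall w, F w = \sum_(i < n) G i w *: x i}].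

Definition add_unit M (k : {ffun 'I_M -> nat}) (m : 'I_M) : {ffun 'I_M -> nat} :=
  [ffun j => (k j + (j == m))%N].

(* Elements of [L^2(E, mu) (x) X] are identified with functions [E -> X]. *)
Definition malliavin_formula (X : normedModType R) n M
    (f : 'I_n -> {ffun 'I_M -> nat} -> R) (B : 'I_M -> set E) (x : 'I_n -> X)
    (w : Omega) (e : E) : X :=
  \sum_(i < n) \sum_(m < M)
    (f i (add_unit (counts B w) m) - f i (counts B w)) *:
      ((\1_(B m) e : R) *: x i).

Definition is_malliavin_derivative (X : normedModType R)
    (F : Omega -> X) (DF : Omega -> E -> X) : Prop :=
  exists (n M : nat) (f : 'I_n -> {ffun 'I_M -> nat} -> R)
         (B : 'I_M -> set E) (x : 'I_n -> X),
    [/\ (1 <= n)%N /\ (1 <= M)%N,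
        forall m, finite_measurable (B m),
        trivIset setT B,
        {ae P, forall w, F w = \sum_(i < n) f i (counts B w) *: x i}
      & DF = malliavin_formula f B x].

(* Every [vector_cylindrical] function has a representation over pairwise
   disjoint sets, and changing it alters the formula on null sets only. *)
Definition malliavin (X : normedModType R) (F : Omega -> X) : Omega -> E -> X :=
  xget (fun _ _ => 0) [set DF | is_malliavin_derivative F DF].

End malliavin.

(* Main.v *)
(** Refine the sets [B_m] of a representation of [F], together with [B], into
    pairwise disjoint sets [C_k].  Their counts form a random vector [V] with
    [F = h(V)] almost surely, and writing [mu_k] for [mu (C_k)] and [e_k] for
    the unit vectors, the independence of its Poisson coordinates gives
    [P(V = v) mu_k = (v_k + 1) P(V = v + e_k)], hence the Mecke identity
    [E (mu_k h(V + e_k)) = E (V_k h(V))].  Summed over the [C_k] contained in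
    [B], the left-hand sides minus [mu(B) E h(V)] give the integral of [DF]
    over [B], and the right-hand sides minus the same term give
    [E (compensated N(B) F)].  A Bochner integral of a function of [V] is a
    limit of finite sums over truncations of the range of [V], and truncating
    along [S] on one side and along [S + e_k] on the other makes the two finite
    sums equal term by term.  In the second half of the statement [F] itself
    need not be integrable; but [mu(B) h(V)] is, which is all that is needed. *)
Require Import Defs.
From HB Require Import structures.
From mathcomp Require Import all_boot all_order all_algebra.
From mathcomp Require Import all_classical all_reals all_analysis.
From mathcomp Require Import measurable_realfun.
From mathcomp Require Import ring.
Import Order.TTheory GRing.Theory Num.Theory.
Import numFieldNormedType.Exports.
Set Implicit Arguments.
Unset Strict Implicit.
Unset Printing Implicit Defensive.
Local Open Scope classical_set_scope.
Local Open Scope ring_scope.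

(** * Functions with finite range *)

Section lower_integral.
Import HBNNSimple.

(** The functions may be non-measurable, so the argument goes through the supremum that defines the
    integral: a simple function below [f], set to zero on the exceptional null set, keeps its
    integral and lies below [g] everywhere. *)
Lemma ge0_ae_le_integralT d (T : measurableType d) (R : realType)
    (mu : {measure set T -> \bar R}) (f g : T -> \bar R) :
  (forall x, 0 <= f x)%E -> (forall x, 0 <= g x)%E ->
  {ae mu, forall x, (f x <= g x)%E} ->
  (\int[mu]_x f x <= \int[mu]_x g x)%E.
Proof.
move=> f0 g0 [N [mN N0 subN]].
rewrite !ge0_integralTE//; apply: ge_ereal_sup => _ [h /= hf <-].
have mC := measurableC mN.
apply: (@le_trans _ _ (sintegral mu (proj_nnsfun h mC))).
  rewrite -!integralT_nnsfun; apply: ae_ge0_le_integral => //.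
  - by move=> x _; rewrite lee_fin.
  - exact/measurable_EFinP.
  - by move=> x _; rewrite lee_fin.
  - exact/measurable_EFinP.
  exists N; split => // x /= /not_implyP [_]; apply: contra_notP => Nx.
  by rewrite /= mindicE mem_set// mulr1.
apply: ereal_sup_ubound; exists (proj_nnsfun h mC) => //= x.
rewrite /= mindicE; have [|_] := boolP (x \in ~` N); last by rewrite mulr0.
rewrite inE mulr1 => Nx.
apply: (le_trans (hf x)); apply: contrapT => H; apply: Nx; exact: subN.
Qed.

End lower_integral.

Lemma measurable_preimage_finite d (T : measurableType d) (U : Type)
    (q : T -> U) : finite_set (range q) ->
  (forall u, measurable (q @^-1` [set u])) ->
  forall Y, measurable (q @^-1` Y).
Proof.
move=> fq mq Y.
have -> : q @^-1` Y = \bigcup_(u in range q `&` Y) (q @^-1` [set u]).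
  apply/seteqP; split => [t Yt|t [u [_ Yu] /= ->]//].
  by exists (q t) => //; split => //; exists t.
by apply: fin_bigcup_measurable => //; exact: finite_setIl.
Qed.

Lemma measurable_preimage_count d (T : measurableType d) (U : countType)
    (q : T -> U) : (forall u, measurable (q @^-1` [set u])) ->
  forall Y, measurable (q @^-1` Y).
Proof.
move=> mq Y.
have -> : q @^-1` Y = \bigcup_u (if u \in Y then q @^-1` [set u] else set0).
  apply/seteqP; split => [t Yt|t [u _]].
    by exists (q t) => //; rewrite mem_set.
  by case: ifPn => //; rewrite inE => Yu /= ->.
apply: countable_bigcupT_measurable => // u.
by case: ifPn => // _; exact: measurable0.
Qed.

(** * Functions that factor through a map with finitely many values *)

Section finite_partition.
Context {R : realType} {d : measure_display} {T : measurableType d}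
  {X : normedModType R} {U : choiceType}.
Variables (mu : {measure set T -> \bar R}) (q : T -> U) (S : seq U).
Hypotheses (uS : uniq S) (qS : forall t, q t \in S).
Hypothesis mq : forall u, measurable (q @^-1` [set u]).

Let finite_q : finite_set (range q).
Proof.
apply: (@sub_finite_set _ _ [set` S]); last exact: finite_seq.
by move=> _ [t _ <-] /=.
Qed.

Let measure_fibre V (phi : U -> V) (x : V) : mu ((phi \o q) @^-1` [set x]) =
  (\sum_(u <- S | `[< phi u = x >]) mu (q @^-1` [set u]))%E.
Proof.
rewrite -big_filter fsbig_seq ?filter_uniq//.
rewrite -measure_fsbig//; last exact: trivIset_preimage1.
congr (mu _); rewrite -fsbig_seq ?filter_uniq// -bigcup_seq.
apply/seteqP; split => [t /= tx|t [u /=]].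
  by exists (q t) => //=; rewrite mem_filter qS andbT; apply/asboolP.
by rewrite mem_filter => /andP[/asboolP <- _] ->.
Qed.

Lemma mu_simple_comp (phi : U -> X) :
  (forall u, phi u != 0 -> (mu (q @^-1` [set u]) < +oo)%E) ->
  mu_simple mu (phi \o q).
Proof.
move=> fphi.
have m Y : measurable ((phi \o q) @^-1` Y).
  by rewrite comp_preimage; exact: measurable_preimage_finite.
split => //.
  by rewrite -(image_comp q phi); apply: finite_image; exact: finite_q.
move=> x x0.
rewrite measure_fibre; apply: lte_sum_pinfty => u /asboolP ux; apply: fphi.
by rewrite ux.
Qed.

(** A fibre of [phi \o q] is a finite disjoint union of fibres of [q], so the integral may be
    computed on this finer partition by grouping the [u] with the same [phi u]. *)
Lemma simple_integral_comp (phi : U -> X) :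
  (forall u, phi u != 0 -> (mu (q @^-1` [set u]) < +oo)%E) ->
  simple_integral mu (phi \o q) =
  \sum_(u <- S) fine (mu (q @^-1` [set u])) *: phi u.
Proof.
move=> fphi; rewrite /simple_integral.
(* [r] may contain vectors that [phi \o q] never takes; their fibres are empty and contribute
   [0]. *)
pose r := undup (map phi S).
rewrite (fsbig_widen _ [set` r]); last 2 first.
- by move=> _ [t _ <-] /=; rewrite mem_undup map_f.
- move=> x [_ /= /preimage10 ->].
  by rewrite measure0 scale0r.
rewrite -fsbig_seq ?undup_uniq//.
transitivity (\sum_(x <- r) \sum_(u <- S | `[< phi u = x >])
    fine (mu (q @^-1` [set u])) *: phi u).
  apply: eq_bigr => x _; have [->|x0] := eqVneq x 0.
    by rewrite scaler0 big1// => u /asboolP ->; rewrite scaler0.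
  rewrite measure_fibre.
  rewrite -sum_fine; last first.
    by move=> u /asboolP ux; rewrite ge0_fin_numE// fphi// ux.
  by rewrite scaler_suml; apply: eq_bigr => u /asboolP ->.
(* After the exchange each [u] meets exactly one [x] of [r], namely [phi u]. *)
rewrite (exchange_big_dep predT)//= [LHS]big_seq [RHS]big_seq.
apply: eq_bigr => u uS'; rewrite -big_filter.
rewrite (_ : [seq _ <- _ | _] = [:: phi u]) ?big_seq1//.
rewrite -(@filter_pred1_uniq _ r) ?undup_uniq ?mem_undup ?map_f//.
by apply: eq_filter => x /=; rewrite eq_sym; apply/asboolP/eqP.
Qed.

Lemma integral_comp_finite (phi : U -> \bar R) : (forall u, 0 <= phi u)%E ->
  (\int[mu]_t phi (q t) = \sum_(u <- S) phi u * mu (q @^-1` [set u]))%E.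
Proof.
move=> phi0.
have -> : [set: T] = \big[setU/set0]_(u <- S) (q @^-1` [set u]).
  rewrite -bigcup_seq; apply/seteqP; split => // t _.
  by exists (q t) => //=; rewrite qS.
rewrite ge0_integral_bigsetU//; last 2 first.
- exact: trivIset_preimage1.
- move=> _ Y _; apply: measurableI; last first.
    rewrite (_ : _ @^-1` _ = q @^-1` (phi @^-1` Y))//.
    exact: measurable_preimage_finite.
  exact: bigsetU_measurable.
apply: eq_bigr => u _; rewrite -integral_cst//.
by apply: eq_integral => t; rewrite inE /= => ->.
Qed.

End finite_partition.

(** * The Bochner integral *)

Lemma cvge0_lt (R : realType) (u : (\bar R)^nat) (e : R) :
  u @ \oo --> 0%E -> 0 < e -> \forall n \near \oo, (u n < e%:E)%E.
Proof.
move=> /fine_cvgP [fu u0] e0.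
near=> n; rewrite -[u n]fineK; last by near: n.
rewrite lte_fin; near: n; exact: (cvgr_lt 0).
Unshelve. all: by end_near. Qed.

Lemma ge0_cvge0 (R : realType) (u v : (\bar R)^nat) :
  (forall n, 0 <= u n)%E -> (forall n, u n <= v n)%E -> v @ \oo --> 0%E ->
  u @ \oo --> 0%E.
Proof.
move=> u0 uv v0; apply: (squeeze_cvge _ _ v0); last exact: cvg_cst.
by apply: nearW => n; rewrite u0 uv.
Qed.

(** * Simple functions on a common partition *)

Section simple.
Context {R : realType} {d : measure_display} {T : measurableType d}
  {X : normedModType R}.
Variable mu : {measure set T -> \bar R}.
Implicit Types s : T -> X.

(** The pair [(s, s')] is a finitely valued map through which both functions factor. A fibre over a
    pair other than [(0, 0)] lies in a fibre of [s] or [s'] over a nonzero vector, hence has finite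
    measure. *)
Lemma mu_simple_pair s s' : mu_simple mu s -> mu_simple mu s' ->
  exists S : seq (X * X), [/\ uniq S, forall t, (s t, s' t) \in S,
    forall u, measurable ((fun t => (s t, s' t)) @^-1` [set u]) &
    forall u, u != (0, 0) ->
      (mu ((fun t => (s t, s' t)) @^-1` [set u]) < +oo)%E].
Proof.
move=> [fs ms bs] [fs' ms' bs'].
pose q t := (s t, s' t).
have pq u : q @^-1` [set u] = s @^-1` [set u.1] `&` s' @^-1` [set u.2].
  by apply/seteqP; split => [t /= <-|t []]//=; case: u => a b /= <- <-.
have mq u : measurable (q @^-1` [set u]) by rewrite pq; exact: measurableI.
exists [seq (x, y) | x <- finmap.enum_fset (fset_set (range s)),
                     y <- finmap.enum_fset (fset_set (range s'))].
split => //.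
- by apply: allpairs_uniq => //= -[a b] [a' b'] /=.
- move=> t; apply/allpairsP; exists (s t, s' t); split => //=.
    by rewrite in_fset_set// inE; exists t.
  by rewrite in_fset_set// inE; exists t.
move=> [a b] /=; rewrite xpair_eqE negb_and => /orP[a0|b0].
  apply: le_lt_trans (bs _ a0); apply: le_measure; rewrite ?inE//.
  by rewrite pq; exact: subIsetl.
apply: le_lt_trans (bs' _ b0); apply: le_measure; rewrite ?inE//.
by rewrite pq; exact: subIsetr.
Qed.

Lemma mu_simple_lin (a b : R) s s' : mu_simple mu s -> mu_simple mu s' ->
  mu_simple mu (fun t => a *: s t + b *: s' t).
Proof.
move=> hs hs'; have [S [uS qS mq bq]] := mu_simple_pair hs hs'.
apply: (mu_simple_comp uS qS mq (phi := fun u => a *: u.1 + b *: u.2)).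
move=> u; have [->|u0 _] := eqVneq u (0, 0); last exact: bq.
by rewrite !scaler0 addr0 eqxx.
Qed.

Lemma simple_integral_lin (a b : R) s s' : mu_simple mu s -> mu_simple mu s' ->
  simple_integral mu (fun t => a *: s t + b *: s' t) =
  a *: simple_integral mu s + b *: simple_integral mu s'.
Proof.
move=> hs hs'; have [S [uS qS mq bq]] := mu_simple_pair hs hs'.
have E (phi : X * X -> X) : phi (0, 0) = 0 ->
    simple_integral mu (fun t => phi (s t, s' t)) =
    \sum_(u <- S) fine (mu ((fun t => (s t, s' t)) @^-1` [set u])) *: phi u.
  move=> phi0; apply: (simple_integral_comp uS qS mq) => u.
  by have [->|u0 _] := eqVneq u (0, 0); [rewrite phi0 eqxx|exact: bq].
rewrite (E (fun u => a *: u.1 + b *: u.2)); last by rewrite !scaler0 addr0.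
rewrite (E fst)// (E snd)// !scaler_sumr -big_split/=.
apply: eq_bigr => u _.
by rewrite scalerDr !scalerA [X in X *: _ + _]mulrC [X in _ + X *: _]mulrC.
Qed.

(** Since the pair has finite range, [phi] can be arbitrary; this gives measurable norms without a
    sigma-algebra on [X]. *)
Lemma measurable_fun_simple2 s s' (phi : X * X -> \bar R) :
  mu_simple mu s -> mu_simple mu s' ->
  measurable_fun setT (fun t => phi (s t, s' t)).
Proof.
move=> hs hs'; have [S [uS qS mq bq]] := mu_simple_pair hs hs'.
move=> _ Y mY; rewrite setTI.
rewrite (_ : _ @^-1` Y = (fun t => (s t, s' t)) @^-1` (phi @^-1` Y))//.
apply: measurable_preimage_finite => //.
apply: (@sub_finite_set _ _ [set` S]); last exact: finite_seq.
by move=> _ [t _ <-] /=.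
Qed.

Lemma le_norm_simple_integral_dist s s' : mu_simple mu s -> mu_simple mu s' ->
  (`|simple_integral mu s - simple_integral mu s'|%:E <=
   \int[mu]_t `|s t - s' t|%:E)%E.
Proof.
move=> hs hs'; have [S [uS qS mq bq]] := mu_simple_pair hs hs'.
pose q t := (s t, s' t).
have -> : simple_integral mu s - simple_integral mu s' =
    simple_integral mu ((fun u => u.1 - u.2) \o q).
  rewrite -[X in X - _]scale1r -[X in _ - X]scale1r -scaleNr.
  rewrite -simple_integral_lin//; congr (simple_integral mu _).
  by apply/funext => t /=; rewrite scale1r scaleN1r.
rewrite (simple_integral_comp uS qS mq); last first.
  move=> u; have [->|u0 _] := eqVneq u (0, 0); last exact: bq.
  by rewrite subrr eqxx.
rewrite (integral_comp_finite mu uS qS mq (phi := fun u => `|u.1 - u.2|%:E))//.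
apply: (@le_trans _ _
    (\sum_(u <- S) `|fine (mu (q @^-1` [set u])) *: (u.1 - u.2)|)%:E).
  by rewrite lee_fin ler_norm_sum.
rewrite -sumEFin; apply: lee_sum => u _.
have [->|u0] := eqVneq u (0, 0).
  by rewrite /= subrr scaler0 normr0 mul0e.
rewrite normrZ ger0_norm ?fine_ge0// mulrC EFinM fineK//.
by rewrite ge0_fin_numE// bq.
Qed.

Lemma integral_norm_simple_lty s : mu_simple mu s ->
  (\int[mu]_t `|s t|%:E < +oo)%E.
Proof.
move=> hs; have [S [uS qS mq bq]] := mu_simple_pair hs hs.
rewrite (integral_comp_finite mu uS qS mq (phi := fun u => `|u.1|%:E))//.
apply: lte_sum_pinfty => u _; have [->|u0] := eqVneq u (0, 0).
  by rewrite /= normr0 mul0e ltry.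
by rewrite lte_mul_pinfty// bq.
Qed.

End simple.

(** * Approximation by simple functions, uniqueness and linearity *)

Section bochner.
Context {R : realType} {d : measure_display} {T : measurableType d}
  {X : normedModType R}.
Variable mu : {measure set T -> \bar R}.
Implicit Types (f g : T -> X) (s : nat -> T -> X) (v w : X).

(** The conditions of [is_bochner_integral] on [s] apart from the convergence of the simple
    integrals, which follows from them when [X] is complete. *)
Definition bochner_approx f s : Prop :=
  [/\ forall n, mu_simple mu (s n),
      {ae mu, forall t, (s n t @[n --> \oo] --> f t)} &
      (\int[mu]_t (`|f t - s n t|)%:E)%E @[n --> \oo] --> 0%E].

(* [f] need not be measurable, but off a null set [`|f - s n|] is the limit of
   the simple functions [`|s m - s n|]; this is what makes the integrals of
   these norms additive. *)
Lemma bochner_approx_norm f s : bochner_approx f s ->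
  exists phi : nat -> T -> \bar R, [/\ forall n, measurable_fun setT (phi n),
    forall n t, (0 <= phi n t)%E,
    {ae mu, forall t, forall n, phi n t = `|f t - s n t|%:E} &
    forall n, (\int[mu]_t phi n t = \int[mu]_t `|f t - s n t|%:E)%E].
Proof.
move=> [hs cs is0].
(* The upper limit is defined and measurable everywhere, also at points where [s m t] diverges. *)
pose phi0 n t : \bar R := limn_esup (fun m => `|s m t - s n t|%:E).
pose phi n t := maxe 0%E (phi0 n t).
have ae : {ae mu, forall t, forall n, phi n t = `|f t - s n t|%:E}.
  apply: filterS cs => t st n.
  have : `|s m t - s n t|%:E @[m --> \oo] --> `|f t - s n t|%:E.
    apply: cvg_EFin; first exact: nearW.
    by apply: cvg_norm; apply: cvgB => //; exact: cvg_cst.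
  move=> /cvg_limn_einf_sup [_].
  by rewrite /phi /phi0 => ->; apply/max_idPr; rewrite lee_fin.
have phige0 n t : (0 <= phi n t)%E by rewrite le_max lexx.
exists phi; split => //.
- move=> n; apply: measurable_maxe => //.
  apply: measurable_fun_limn_esup => m.
  exact: (measurable_fun_simple2 (fun u => `|u.1 - u.2|%:E) (hs m) (hs n)).
- move=> n; apply/eqP; rewrite eq_le.
  by rewrite !ge0_ae_le_integralT//; apply: filterS ae => t ->.
Qed.

(** Triangle inequality through [f]; the measurable versions [phi] and [psi] of the two error norms
    allow their integrals to be added. *)
Lemma bochner_approx_dist f s s' n m : bochner_approx f s ->
  bochner_approx f s' ->
  (`|simple_integral mu (s n) - simple_integral mu (s' m)|%:E <=
   \int[mu]_t `|f t - s n t|%:E + \int[mu]_t `|f t - s' m t|%:E)%E.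
Proof.
move=> hs hs'; have [phi [mphi phi0 aephi <-]] := bochner_approx_norm hs.
have [psi [mpsi psi0 aepsi <-]] := bochner_approx_norm hs'.
case: hs hs' => [hs _ _] [hs' _ _].
apply: (le_trans (le_norm_simple_integral_dist (hs n) (hs' m))).
rewrite -ge0_integralD//; apply: ge0_ae_le_integralT => //.
  by move=> t; exact: adde_ge0.
apply: filterS2 aephi aepsi => t -> ->.
by rewrite -EFinD lee_fin -[`|f t - s n t|]distrC ler_distD.
Qed.

(** Two approximating sequences have integrals that differ at rank [n] by at most the sum of the two
    errors, which tends to [0]. Hence the [xget] in [bochner_integral] has a single candidate. *)
Lemma is_bochner_integral_unique f v w :
  is_bochner_integral mu f v -> is_bochner_integral mu f w -> v = w.
Proof.
move=> [s [s1 s2 s3 sv]] [s' [s'1 s'2 s'3 s'w]].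
have hs : bochner_approx f s by split.
have hs' : bochner_approx f s' by split.
have d0 : (simple_integral mu (s n) - simple_integral mu (s' n))
    @[n --> \oo] --> (0 : X).
  apply: norm_cvg0.
  apply: (@fine_cvg _ _ _ _ (fun n => `|simple_integral mu (s n) -
      simple_integral mu (s' n)|%:E)).
  apply: ge0_cvge0 => // [n|]; first exact: (bochner_approx_dist n n hs hs').
  by rewrite -[0%E]adde0; exact: cvgeD.
apply/eqP; rewrite -subr_eq0; apply/eqP.
apply: (@norm_cvg_unique _ _ _ _ _ _ _ d0); exact: cvgB.
Qed.

Lemma bochner_integralE f v :
  is_bochner_integral mu f v -> bochner_integral mu f = v.
Proof.
move=> fv; apply: xget_unique => // w fw.
exact: is_bochner_integral_unique fw fv.
Qed.

(** Choose [n] with error below [1] and use that [|f|] is at most [|f - s n| + |s n|]. *)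
Lemma integral_norm_bochner_lty f v : is_bochner_integral mu f v ->
  (\int[mu]_t `|f t|%:E < +oo)%E.
Proof.
move=> [s [s1 s2 s3 _]].
have hs : bochner_approx f s by split.
have [phi [mphi phi0 aephi phiE]] := bochner_approx_norm hs.
have [n _ /(_ n (leqnn n)) /= fn] := cvge0_lt s3 ltr01.
apply: (@le_lt_trans _ _ (\int[mu]_t (phi n t + `|s n t|%:E))%E).
  apply: ge0_ae_le_integralT => //.
    by move=> t; exact: adde_ge0.
  apply: filterS aephi => t ->; rewrite -EFinD lee_fin.
  by rewrite -[in leLHS](subrK (s n t) (f t)) ler_normD.
rewrite ge0_integralD//; last first.
  exact: (measurable_fun_simple2 (fun u => `|u.1|%:E) (s1 n) (s1 n)).
rewrite lte_add_pinfty//; last exact: integral_norm_simple_lty.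
by rewrite phiE; apply: lt_trans fn _; rewrite ltry.
Qed.

Lemma is_bochner_integral_ae f g v : {ae mu, forall t, f t = g t} ->
  is_bochner_integral mu f v -> is_bochner_integral mu g v.
Proof.
move=> fg [s [s1 s2 s3 sv]]; exists s; split => //.
  by apply: filterS2 fg s2 => t ->.
apply: ge0_cvge0 s3 => n; first exact: integral_ge0.
by apply: ge0_ae_le_integralT => //; apply: filterS fg => t ->.
Qed.

Lemma is_bochner_integral_lin (a b : R) f g v w :
  is_bochner_integral mu f v -> is_bochner_integral mu g w ->
  is_bochner_integral mu (fun t => a *: f t + b *: g t) (a *: v + b *: w).
Proof.
move=> [s [s1 s2 s3 sv]] [s' [s'1 s'2 s'3 s'w]].
have hs : bochner_approx f s by split.
have hs' : bochner_approx g s' by split.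
have [phi [mphi phi0 aephi phiE]] := bochner_approx_norm hs.
have [psi [mpsi psi0 aepsi psiE]] := bochner_approx_norm hs'.
exists (fun n t => a *: s n t + b *: s' n t); split.
- by move=> n; exact: mu_simple_lin.
- apply: filterS2 s2 s'2 => t st s't.
  by apply: cvgD; apply: cvgZr.
- apply: (@ge0_cvge0 _ _ (fun n => `|a|%:E * \int[mu]_t `|f t - s n t|%:E +
      `|b|%:E * \int[mu]_t `|g t - s' n t|%:E)%E).
  + by move=> n; exact: integral_ge0.
  + move=> n; rewrite -phiE -psiE -!ge0_integralZl_EFin// -ge0_integralD//;
      last 4 first.
    * by move=> t _; rewrite mule_ge0.
    * exact: measurable_funeM.
    * by move=> t _; rewrite mule_ge0.
    * exact: measurable_funeM.
    apply: ge0_ae_le_integralT => //.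
      by move=> t; rewrite adde_ge0// mule_ge0.
    apply: filterS2 aephi aepsi => t -> ->.
    rewrite -!EFinM -EFinD lee_fin -!normrZ !scalerBr opprD addrACA.
    exact: ler_normD.
  + have c (r : R) (u : (\bar R)^nat) : u @ \oo --> 0%E ->
        (r%:E * u n)%E @[n --> \oo] --> 0%E.
      by move=> u0; rewrite -(mule0 r%:E); exact: cvgeZl.
    by rewrite -[0%E]adde0; apply: cvgeD => //; exact: c.
- under eq_fun do rewrite simple_integral_lin//.
  by apply: cvgD; apply: cvgZr.
Qed.

Lemma is_bochner_integral_simple (s : T -> X) : mu_simple mu s ->
  is_bochner_integral mu s (simple_integral mu s).
Proof.
move=> hs; exists (fun _ => s); split => //.
- by apply: aeW => t; exact: cvg_cst.
- under eq_fun do under eq_integral do rewrite subrr normr0.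
  by rewrite integral0; exact: cvg_cst.
- exact: cvg_cst.
Qed.

Lemma is_bochner_integral_indic (A : set T) (x : X) :
  measurable A -> (mu A < +oo)%E ->
  is_bochner_integral mu (fun t => (\1_A t : R) *: x) (fine (mu A) *: x).
Proof.
move=> mA fA.
(* The complement of [A] may have infinite measure, but [phi] is [0] there. *)
pose q t := t \in A.
pose phi b : X := if b then x else 0.
have qt : q @^-1` [set true] = A.
  by apply/seteqP; split => t; [exact: set_mem|exact: mem_set].
have mq b : measurable (q @^-1` [set b]).
  case: b; first by rewrite qt.
  rewrite (_ : _ @^-1` _ = ~` A); first exact: measurableC.
  apply/seteqP; split => t /=; rewrite /q.
    by move=> /negbT; rewrite notin_setE.
  by move=> /mem_set; rewrite in_setC => /negbTE.
have fq b : phi b != 0 -> (mu (q @^-1` [set b]) < +oo)%E.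
  by case: b => /=; rewrite ?qt// eqxx.
have uS : uniq [:: true; false] by [].
have qS t : q t \in [:: true; false] by case: (q t).
have := is_bochner_integral_simple (mu_simple_comp uS qS mq fq).
rewrite (simple_integral_comp uS qS mq fq) !big_cons big_nil qt /=.
rewrite scaler0 !addr0; congr is_bochner_integral.
apply/funext => t; rewrite /phi /= indicE /q.
by case: (t \in A); rewrite ?scale1r ?scale0r.
Qed.

Lemma is_bochner_integral0 : is_bochner_integral mu (fun _ => 0 : X) 0.
Proof.
have := @is_bochner_integral_indic set0 (0 : X) measurable0.
rewrite measure0 => /(_ (ltry _)); rewrite scaler0.
by congr is_bochner_integral; apply/funext => t; rewrite scaler0.
Qed.

Lemma is_bochner_integralB f g v w : is_bochner_integral mu f v ->
  is_bochner_integral mu g w ->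
  is_bochner_integral mu (fun t => f t - g t) (v - w).
Proof.
move=> fv gw; have := is_bochner_integral_lin 1 (-1) fv gw.
rewrite scale1r scaleN1r; congr is_bochner_integral.
by apply/funext => t; rewrite scale1r scaleN1r.
Qed.

Lemma is_bochner_integral_sum (I : Type) (r : seq I) (Q : pred I)
    (f : I -> T -> X) (v : I -> X) :
  (forall i, Q i -> is_bochner_integral mu (f i) (v i)) ->
  is_bochner_integral mu (fun t => \sum_(i <- r | Q i) f i t)
    (\sum_(i <- r | Q i) v i).
Proof.
move=> fv; elim: r => [|i r ih].
  rewrite big_nil; have := is_bochner_integral0; congr is_bochner_integral.
  by apply/funext => t; rewrite big_nil.
rewrite big_cons; case: ifPn => Qi; last first.
  move: ih; congr is_bochner_integral.
  by apply/funext => t; rewrite big_cons (negbTE Qi).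
have := is_bochner_integral_lin 1 1 (fv i Qi) ih.
rewrite !scale1r; congr is_bochner_integral.
by apply/funext => t; rewrite !scale1r big_cons Qi.
Qed.

End bochner.

(** The place where completeness enters: once the errors are below [e / 2], the simple integrals are
    within [e] of each other. *)
Lemma bochner_approx_cvg (R : realType) (d : measure_display)
    (T : measurableType d) (X : completeNormedModType R)
    (mu : {measure set T -> \bar R}) (f : T -> X) (s : nat -> T -> X) :
  bochner_approx mu f s ->
  exists v : X, simple_integral mu (s n) @[n --> \oo] --> v.
Proof.
move=> hs; apply/cvg_ex; apply: cauchy_cvg; apply: cauchy_exP => e e0.
have e20 : 0 < e / 2 by rewrite divr_gt0.
have [_ _ s3] := hs.
have [N _ HN] := cvge0_lt s3 e20.
exists (simple_integral mu (s N)); exists N => // n /= Nn.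
rewrite -ball_normE /= -lte_fin.
apply: (le_lt_trans (bochner_approx_dist N n hs hs)).
by rewrite (splitr e) EFinD lteD//; apply: HN => /=.
Qed.

(** * Functions of a countably valued random variable *)

Section countable_valued.
Context {R : realType} {d : measure_display} {Omega : measurableType d}
  {X : completeNormedModType R} {T : countType}.
Variables (P : probability Omega R) (Z : Omega -> T).
Hypothesis mZ : forall t, measurable (Z @^-1` [set t]).

Local Notation p t := (fine (P (Z @^-1` [set t]))).

Let PZE t : P (Z @^-1` [set t]) = (p t)%:E.
Proof. by rewrite fineK// fin_num_measure. Qed.

Lemma measurable_fun_comp_count (phi : T -> \bar R) :
  measurable_fun setT (phi \o Z).
Proof.
move=> _ Y _; rewrite setTI comp_preimage.
exact: measurable_preimage_count.
Qed.

Lemma integral_comp_count (phi : T -> \bar R) : (forall t, 0 <= phi t)%E ->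
  (\int[P]_w phi (Z w) = \esum_(t in setT) phi t * P (Z @^-1` [set t]))%E.
Proof.
move=> phi0.
(* [pickle] numbers the fibres of [Z]; a number that encodes no value of [T] gives the empty set and
   drops out at the end. *)
pose F n := Z @^-1` (pickle @^-1` [set n]).
pose G n := (\int[P]_(w in F n) phi (Z w))%E.
have mF n : measurable (F n) by exact: measurable_preimage_count.
have G0 n : (0 <= G n)%E by exact: integral_ge0.
have -> : (\int[P]_w phi (Z w) = \esum_(n in setT) G n)%E.
  rewrite -nneseries_esumT// -ge0_integral_bigcup//.
  - congr integral; apply/seteqP; split => // w _.
    by exists (pickle (Z w)).
  - move=> _ Y mY; apply: measurableI; first exact: bigcup_measurable.
    by have := measurable_fun_comp_count phi measurableT mY; rewrite setTI.
  - by move=> i j _ _ [w [/= <- <-]].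
have GE t : G (pickle t) = (phi t * P (Z @^-1` [set t]))%E.
  rewrite /G (_ : F _ = Z @^-1` [set t]); last first.
    apply/seteqP; split => w /=; last by move=> <-.
    by move/(pcan_inj pickleK).
  rewrite -integral_cst//; apply: eq_integral => w.
  by rewrite inE /= => ->.
under [RHS]eq_esum do rewrite -GE.
rewrite -(esum_image setT pickle G); last first.
  by move=> ? ? _ _; exact: (pcan_inj pickleK).
rewrite [RHS]esum_mkcond; apply: eq_esum => n _.
case: ifPn => // /negP Hn; rewrite /G.
rewrite (_ : F n = set0) ?integral_set0//.
by apply/seteqP; split => // w /= wn; apply: Hn; rewrite inE -wn; exists (Z w).
Qed.

(** * Truncation to finitely many values *)

Section truncation.
Variables (f : T -> X) (S : seq T).
Hypothesis uS : uniq S.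

Definition truncation w : X := if Z w \in S then f (Z w) else 0.

(** All values outside [S] collapse to [None], which [oapp f 0] sends to [0]; this makes a
    truncation factor through finitely many values. *)
Let q w := if Z w \in S then Some (Z w) else None.
Let S' := None :: map Some S.

Let uS' : uniq S'.
Proof.
rewrite /S' /= map_inj_uniq ?uS ?andbT//.
by apply/mapP => -[].
Qed.

Let qS' w : q w \in S'.
Proof.
rewrite /q /S'; case: ifPn => // wS.
by rewrite inE mem_map ?wS ?orbT// => ? ? [].
Qed.

Let mq u : measurable (q @^-1` [set u]).
Proof.
rewrite (_ : q @^-1` _ = Z @^-1` [set t |
  (if t \in S then Some t else None) = u])//.
exact: measurable_preimage_count.
Qed.

Let truncationE : truncation = oapp f 0 \o q.
Proof. by apply/funext => w; rewrite /truncation /= /q; case: ifP. Qed.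

Let fin_q u : oapp f 0 u != 0 -> (P (q @^-1` [set u]) < +oo)%E.
Proof. by move=> _; rewrite -ge0_fin_numE// fin_num_measure. Qed.

Lemma mu_simple_truncation : mu_simple P truncation.
Proof. by rewrite truncationE; exact: (mu_simple_comp uS' qS' mq). Qed.

Lemma simple_integral_truncation :
  simple_integral P truncation = \sum_(t <- S) p t *: f t.
Proof.
rewrite truncationE (simple_integral_comp uS' qS' mq fin_q).
rewrite big_cons /= scaler0 add0r big_map big_seq [RHS]big_seq.
apply: eq_bigr => t tS; congr (fine (P _) *: _).
apply/seteqP; split => w /=; rewrite /q; last by move=> ->; rewrite tS.
by case: ifP => // _ [].
Qed.

End truncation.

Definition norm_integrable (f : T -> X) :=
  (\int[P]_w `|f (Z w)|%:E < +oo)%E.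

(** At each point the truncations are eventually exact, and the error is dominated by the integrable
    norm of [f]. The lists need to exhaust only the support of [f], so that images of an injection
    can serve as [S]. *)
Lemma bochner_approx_truncation (f : T -> X) (S : nat -> seq T) :
  (forall n, uniq (S n)) ->
  (forall t, f t != 0 -> \forall n \near \oo, t \in S n) ->
  norm_integrable f ->
  bochner_approx P (f \o Z) (fun n => truncation f (S n)).
Proof.
move=> uS fS fi.
have cv w : truncation f (S n) w @[n --> \oo] --> f (Z w).
  have [f0|f0] := eqVneq (f (Z w)) 0.
    rewrite f0 (_ : (fun n => _) = fun=> 0); first exact: cvg_cst.
    by apply/funext => n; rewrite /truncation f0; case: ifP.
  apply: cvg_near_cst; apply: filterS (fS _ f0) => n.
  by rewrite /truncation => ->.
split; first by move=> n; exact: mu_simple_truncation.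
  by apply: aeW => w; exact: cv.
pose g_ n w : \bar R := `|f (Z w) - truncation f (S n) w|%:E.
have mg n : measurable_fun setT (g_ n).
  exact: (measurable_fun_comp_count
    (fun t => `|f t - (if t \in S n then f t else 0)|%:E)).
have mf : measurable_fun setT (fun w => `|f (Z w)|%:E : \bar R).
  exact: (measurable_fun_comp_count (fun t => `|f t|%:E)).
have := @dominated_convergence _ _ _ P setT measurableT g_ (cst 0%E)
  (fun w => `|f (Z w)|%:E) mg (@measurable_cst _ _ _ _ _ _).
rewrite integral0; case => //.
- apply: aeW => w _; apply: cvg_EFin; first exact: nearW.
  rewrite -(@normr0 _ X) -(subrr (f (Z w))).
  by apply: cvg_norm; apply: cvgB; [exact: cvg_cst|exact: cv].
- apply/integrableP; split => //.
  by under eq_integral do rewrite gee0_abs//.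
- apply: aeW => w n _; rewrite /g_ gee0_abs ?lee_fin// /truncation.
  by case: ifP => _; rewrite ?subr0// subrr normr0.
Qed.

Let enum_seq n : seq T := pmap pickle_inv (iota 0 n).

Let uniq_enum_seq n : uniq (enum_seq n).
Proof.
by rewrite /enum_seq (pmap_uniq (@pickle_invK _))// ?iota_uniq.
Qed.

Let enum_seqP t : \forall n \near \oo, t \in enum_seq n.
Proof.
exists (pickle t).+1 => // n /= tn; rewrite mem_pmap.
by apply/mapP; exists (pickle t); rewrite ?pickleK_inv// mem_iota.
Qed.

Lemma bochner_integrable_comp_count (f : T -> X) : norm_integrable f ->
  bochner_integrable P (f \o Z).
Proof.
move=> fi.
have ap := bochner_approx_truncation uniq_enum_seq (fun t _ => enum_seqP t) fi.
have [v sv] := bochner_approx_cvg ap.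
by case: ap => s1 s2 s3; exists v; exists (fun n => truncation f (enum_seq n)).
Qed.

Lemma norm_integrableP (f : T -> X) (F : Omega -> X) :
  {ae P, forall w, F w = f (Z w)} ->
  bochner_integrable P F <-> norm_integrable f.
Proof.
move=> Ff.
split => [[v /(is_bochner_integral_ae Ff)]|/bochner_integrable_comp_count [v fv]].
  exact: integral_norm_bochner_lty.
by exists v; apply: is_bochner_integral_ae fv; apply: filterS Ff => w ->.
Qed.

Lemma norm_integrable_le (f : T -> X) (a : T -> R) : (forall t, 0 <= a t) ->
  (forall t, `|f t| <= a t) -> (\int[P]_w (a (Z w))%:E < +oo)%E ->
  norm_integrable f.
Proof.
move=> a0 fa; apply: le_lt_trans; apply: ge0_ae_le_integralT => //.
  by move=> w; rewrite lee_fin.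
by apply: aeW => w; rewrite lee_fin.
Qed.

Lemma norm_integrableZ (a : R) (f : T -> X) : norm_integrable f ->
  norm_integrable (fun t => a *: f t).
Proof.
move=> fi; rewrite /norm_integrable.
under eq_integral do rewrite normrZ EFinM.
rewrite ge0_integralZl_EFin// ?lte_mul_pinfty//.
exact: (measurable_fun_comp_count (fun t => `|f t|%:E)).
Qed.

(** * The Mecke identity for one shift *)

Section mecke.
(** In the application [T] consists of count vectors, [sigma] adds one point to a set, [c] is the
    count of that set and [m] its measure. *)
Variables (sigma : T -> T) (c : T -> R) (m : R).
Hypotheses (sigma_inj : injective sigma) (c0 : forall t, 0 <= c t) (m0 : 0 <= m).
Hypothesis c_sigma : forall t, c t != 0 -> exists t', t = sigma t'.
Hypothesis mecke : forall t, p t * m = c (sigma t) * p (sigma t).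

(** By [mecke] the left-hand side is the right-hand sum restricted to the image of [sigma]; the
    remaining terms are non-negative. *)
Lemma le_mecke (phi : T -> R) : (forall t, 0 <= phi t) ->
  (\int[P]_w (m * phi (sigma (Z w)))%:E <=
   \int[P]_w (c (Z w) * phi (Z w))%:E)%E.
Proof.
move=> phi0.
rewrite (@integral_comp_count (fun t => (m * phi (sigma t))%:E)); last first.
  by move=> t; rewrite lee_fin mulr_ge0.
rewrite (@integral_comp_count (fun t => (c t * phi t)%:E)); last first.
  by move=> t; rewrite lee_fin mulr_ge0.
pose a t : \bar R := ((c t * phi t)%:E * P (Z @^-1` [set t]))%E.
under eq_esum => t _.
  rewrite PZE -EFinM mulrAC [m * _]mulrC mecke mulrAC EFinM -PZE -/(a (sigma t)).
  over.
rewrite -(esum_image setT sigma a); last by move=> ? ? _ _; exact: sigma_inj.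
rewrite esum_mkcond; apply: le_esum => t _.
by case: ifP => // _; rewrite mule_ge0// lee_fin mulr_ge0.
Qed.

(** Both integrals are limits of the same finite sums, taken over [enum_seq n] on one side and over
    its image under [sigma] on the other. Integrability passes to the shifted function by [le_mecke]
    applied to the norm of [h]. *)
Lemma bochner_mecke (h : T -> X) :
  norm_integrable (fun t => c t *: h t) ->
  exists v, is_bochner_integral P (fun w => m *: h (sigma (Z w))) v /\
            is_bochner_integral P (fun w => c (Z w) *: h (Z w)) v.
Proof.
move=> hi; have hi' : norm_integrable (fun t => m *: h (sigma t)).
  apply: le_lt_trans hi.
  under eq_integral do rewrite normrZ (ger0_norm m0).
  under [leRHS]eq_integral do rewrite normrZ ger0_norm//.
  by apply: (@le_mecke (fun t => `|h t|)) => t.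
have ap := bochner_approx_truncation uniq_enum_seq (fun t _ => enum_seqP t) hi'.
pose S n := map sigma (enum_seq n).
have uS n : uniq (S n) by rewrite map_inj_uniq.
(* The shifted lists exhaust only the image of [sigma], but [c] vanishes off it. *)
have hS t : c t *: h t != 0 -> \forall n \near \oo, t \in S n.
  rewrite scaler_eq0 negb_or => /andP[/c_sigma [t' ->] _].
  by apply: filterS (enum_seqP t') => n; rewrite mem_map.
have ap' := bochner_approx_truncation uS hS hi.
have [v sv] := bochner_approx_cvg ap; exists v; split.
  by case: ap => s1 s2 s3;
  exists (fun n => truncation (fun t => m *: h (sigma t)) (enum_seq n)).
case: ap' => s1 s2 s3; exists (fun n => truncation (fun t => c t *: h t) (S n)).
split => //; move: sv.
set u := (X in X @ \oo --> _ -> _); set u' := (X in _ -> X @ \oo --> _).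
suff -> : u = u' by [].
rewrite /u /u'; apply/funext => n.
rewrite !simple_integral_truncation// big_map.
by apply: eq_bigr => t _; rewrite !scalerA mecke [c _ * _]mulrC.
Qed.

End mecke.

End countable_valued.

(** With [k] the integer part of [x], take [e = 1] if [x = k], and otherwise the smaller of the
    distances from [x] to [k] and [k + 1]. *)
Lemma nat_isolated (R : realType) (x : R) : 0 <= x ->
  exists2 e : R, 0 < e & forall n : nat, n%:R != x -> e <= `|n%:R - x|.
Proof.
move=> x0; have := truncn_itv x0.
set k := Num.truncn x => /andP[kx xk].
have far n e : (n <= k)%N && (e <= x - n%:R) || (k < n)%N -> e <= k.+1%:R - x ->
    e <= `|n%:R - x|.
  move=> /orP[/andP[_ ex] _|kn ex].
    by rewrite distrC (le_trans ex)// ler_norm.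
  rewrite (le_trans _ (ler_norm _))// (le_trans ex)// lerD2r ler_nat//.
have [kE|kN] := eqVneq k%:R x.
  exists 1 => // n nx; apply: far; last by rewrite -kE -natrB// subSnn.
  case: ltnP; rewrite ?orbT//= orbF => nk.
  have {}nk : (n < k)%N.
    by rewrite ltn_neqAle nk andbT; apply: contra nx => /eqP ->; rewrite kE.
  by rewrite -kE lerBrDr addrC natr1 ler_nat.
exists (Num.min (x - k%:R) (k.+1%:R - x)).
  by rewrite lt_min !subr_gt0 xk andbT lt_neqAle kN.
move=> n nx; apply: far; last by rewrite ge_min lexx orbT.
case: ltnP; rewrite ?orbT//= orbF => nk.
by rewrite ge_min lerD2l lerN2 ler_nat nk.
Qed.

(** * The Mecke identity summed over finitely many shifts *)

Section mecke_family.
Context {R : realType} {d : measure_display} {Omega : measurableType d}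
  {X : completeNormedModType R} {T : countType} {J : finType}.
Variables (P : probability Omega R) (Z : Omega -> T).
Hypothesis mZ : forall t, measurable (Z @^-1` [set t]).
Variables (D : pred J) (sigma : J -> T -> T) (c : J -> T -> nat) (m : J -> R).
Hypotheses (sigma_inj : forall j, injective (sigma j)).
Hypothesis m0 : forall j, 0 <= m j.
Hypothesis c_sigma : forall j t, c j t != 0 -> exists t', t = sigma j t'.
Hypothesis mecke : forall j t, fine (P (Z @^-1` [set t])) * m j =
  (c j (sigma j t))%:R * fine (P (Z @^-1` [set sigma j t])).

(** In the application [D] selects the refined sets inside [B]: then [n] is the count of [B], [lam]
    its measure, and [G] and [H] below express the integral of the derivative over [B] and the
    compensated product through the count vector. *)
Let n t : nat := \sum_(j | D j) c j t.
Let lam := \sum_(j | D j) m j.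
Hypothesis n_sigma : forall j t, D j -> n (sigma j t) = (n t).+1.

Variable h : T -> X.
Let G t := \sum_(j | D j) m j *: (h (sigma j t) - h t).
Let H t := ((n t)%:R - lam) *: h t.

Let lam0 : 0 <= lam. Proof. by apply: sumr_ge0. Qed.

Let GE t : G t = \sum_(j | D j) m j *: h (sigma j t) - lam *: h t.
Proof.
by rewrite /G scaler_suml -sumrB; apply: eq_bigr => j _; rewrite scalerBr.
Qed.

Let HE t : H t = \sum_(j | D j) (c j t)%:R *: h t - lam *: h t.
Proof. by rewrite /H scalerBl natr_sum scaler_suml. Qed.

Local Notation integrable := (norm_integrable P Z).

Let integrable_leD (a b : R) (f g k : T -> X) : 0 <= a -> 0 <= b ->
  (forall t, `|k t| <= a * `|f t| + b * `|g t|) ->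
  integrable f -> integrable g -> integrable k.
Proof.
move=> a0 b0 kfg fi gi.
apply: (norm_integrable_le _ kfg).
  by move=> t; rewrite addr_ge0// mulr_ge0.
under eq_integral do rewrite EFinD !EFinM.
have M (f' : T -> X) : measurable_fun setT (fun w => `|f' (Z w)|%:E : \bar R).
  exact: (measurable_fun_comp_count mZ (fun t => `|f' t|%:E)).
rewrite ge0_integralD//; last 4 first.
- by move=> w _; rewrite mule_ge0.
- exact: measurable_funeM.
- by move=> w _; rewrite mule_ge0.
- exact: measurable_funeM.
by rewrite !ge0_integralZl_EFin// lte_add_pinfty// lte_mul_pinfty.
Qed.

(** The sum of [H] and [lam *: h] is [n *: h], which dominates every [c j *: h]; so the single-shift
    identity applies to each [j], and the integral of [lam *: h] is subtracted on both sides.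
    Integrability is asked of [lam *: h], which is weaker than that of [h] when [lam = 0]. *)
Lemma bochner_mecke_family : integrable (fun t => lam *: h t) -> integrable H ->
  exists v, is_bochner_integral P (G \o Z) v /\
            is_bochner_integral P (H \o Z) v.
Proof.
move=> hi Hi.
have ci j : D j -> integrable (fun t => (c j t)%:R *: h t).
  move=> Dj; apply: (integrable_leD ler01 ler01 _ Hi hi) => t; rewrite !mul1r.
  apply: (@le_trans _ _ `|(n t)%:R *: h t|).
    rewrite !normrZ ler_wpM2r// !ger0_norm// ler_nat /n (bigD1 j)//=.
    exact: leq_addr.
  by rewrite (le_trans _ (ler_normD _ _))// /H scalerBl subrK.
have [u hu] := bochner_integrable_comp_count mZ hi.
have /choice [v hv] j : exists v, D j ->
    is_bochner_integral P (fun w => m j *: h (sigma j (Z w))) v /\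
    is_bochner_integral P (fun w => (c j (Z w))%:R *: h (Z w)) v.
  case: (boolP (D j)) => [Dj|_]; last by exists 0.
  have c_sig t : (c j t)%:R != 0 :> R -> exists t', t = sigma j t'.
    by rewrite pnatr_eq0; exact: c_sigma.
  have [v hv] := bochner_mecke mZ (@sigma_inj j) (fun t => ler0n R (c j t))
    (m0 j) c_sig (mecke j) (ci _ Dj).
  by exists v.
exists (\sum_(j | D j) v j - u); split.
  have := is_bochner_integralB (is_bochner_integral_sum (index_enum J)
    (fun j Dj => (hv j Dj).1)) hu.
  by congr is_bochner_integral; apply/funext => w /=; rewrite GE.
have := is_bochner_integralB (is_bochner_integral_sum (index_enum J)
  (fun j Dj => (hv j Dj).2)) hu.
by congr is_bochner_integral; apply/funext => w /=; rewrite HE.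
Qed.

(* Where [n t != lam], [`|h t|] is controlled by [`|H t|].  Where [n t = lam],
   [lam *: h t] differs from [- G t] by values of [h] at points where
   [n = lam + 1] and so [H = h]. *)
Lemma norm_integrable_mecke_family : integrable G -> integrable H ->
  integrable (fun t => lam *: h t).
Proof.
move=> Gi Hi.
pose phi t : R := if (n t)%:R == lam + 1 then `|h t| else 0.
have phi0 t : 0 <= phi t by rewrite /phi; case: ifP.
have phi_fin j : D j ->
    (\int[P]_w (m j * phi (sigma j (Z w)))%:E < +oo)%E.
  (* Where [phi] is nonzero, [c j] is at most [n = lam + 1] and [H = h], so [c j * phi] is at most
     [(lam + 1) * |H|]. *)
  move=> Dj; apply: (le_lt_trans (le_mecke mZ (@sigma_inj j)
    (fun t => ler0n R (c j t)) (m0 j) (mecke j) phi0)).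
  have := Hi; rewrite /norm_integrable => Hi'.
  apply: (@le_lt_trans _ _ (\int[P]_w ((lam + 1)%:E * `|H (Z w)|%:E))%E).
    apply: ge0_ae_le_integralT.
    - by move=> w; rewrite lee_fin mulr_ge0.
    - by move=> w; rewrite mule_ge0// lee_fin addr_ge0.
    apply: aeW => w; rewrite -EFinM lee_fin /phi /H.
    case: eqP => [nw|_]; last by rewrite mulr0 mulr_ge0// addr_ge0.
    rewrite nw addrAC subrr add0r scale1r ler_wpM2r// -nw ler_nat.
    by rewrite /n (bigD1 j)//= leq_addr.
  rewrite ge0_integralZl_EFin//; last 2 first.
  - exact: (measurable_fun_comp_count mZ (fun t => `|H t|%:E)).
  - by rewrite addr_ge0.
  by rewrite lte_mul_pinfty// lee_fin addr_ge0.
(* The part of [lam *: h] on which [H] vanishes; it is controlled by [G] and the shifted [phi]. *)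
pose k1 t := if (n t)%:R == lam then lam *: h t else 0.
have k1i : integrable k1.
  pose a t := `|G t| + \sum_(j | D j) m j * phi (sigma j t).
  have s0 t : 0 <= \sum_(j | D j) m j * phi (sigma j t).
    by apply: sumr_ge0 => j _; rewrite mulr_ge0.
  apply: (@norm_integrable_le _ _ _ _ _ _ _ _ a).
  - by move=> t; rewrite addr_ge0.
  - move=> t; rewrite /k1 /a; case: eqP => nt; last by rewrite normr0 addr_ge0.
    have -> : lam *: h t = - G t + \sum_(j | D j) m j *: h (sigma j t).
      by rewrite GE opprB subrK.
    rewrite (le_trans (ler_normD _ _))// normrN lerD2l.
    rewrite (le_trans (ler_norm_sum _ _ _))//; apply: ler_sum => j Dj.
    by rewrite normrZ ger0_norm// /phi n_sigma// -natr1 nt eqxx.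
  under eq_integral do rewrite EFinD -sumEFin.
  rewrite ge0_integralD//; last 3 first.
  - exact: (measurable_fun_comp_count mZ (fun t => `|G t|%:E)).
  - by move=> w _; rewrite sumEFin lee_fin.
  - exact: (measurable_fun_comp_count mZ (fun t =>
      \sum_(j | D j) (m j * phi (sigma j t))%:E)%E).
  apply: lte_add_pinfty => //.
  under eq_integral do rewrite big_mkcond.
  rewrite ge0_integral_sum//; last 2 first.
  - move=> j; exact: (measurable_fun_comp_count mZ (fun t =>
      if D j then (m j * phi (sigma j t))%:E else 0%E)).
  - by move=> j w _; case: ifP => // _; rewrite lee_fin mulr_ge0.
  apply: lte_sum_pinfty => j _; case: (boolP (D j)) => Dj; first exact: phi_fin.
  by rewrite integral0.
(* Off [n = lam] the distance from [n] to [lam] is at least [e], whence the factor [lam / e] in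
   front of the norm of [H]. *)
have [e e0 he] := nat_isolated lam0.
have ae0 : 0 <= lam / e by rewrite divr_ge0// ltW.
apply: (integrable_leD ae0 ler01 _ Hi k1i) => t; rewrite mul1r /k1.
case: eqP => [_|/eqP nt]; first by rewrite lerDr mulr_ge0.
rewrite normr0 addr0 !normrZ mulrA ler_wpM2r// ger0_norm//.
by rewrite -mulrA ler_peMr// ler_pdivlMl// mulr1 he.
Qed.

End mecke_family.

(** * Counts of a Poisson random measure *)

Lemma truncn_nat (R : realType) (n : nat) : Num.truncn (n%:R : R) = n.
Proof. by apply: truncn_def; rewrite lexx ltr_nat ltnSn. Qed.

Lemma measure_bigcup_ord d (T : measurableType d) (R : realType)
    (mu : {measure set T -> \bar R}) K (C : 'I_K -> set T) (Q : pred 'I_K) :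
  (forall k, measurable (C k)) -> trivIset setT C ->
  mu (\bigcup_(k in [set k | Q k]) C k) = (\sum_(k < K | Q k) mu (C k))%E.
Proof.
move=> mC tC; rewrite -big_filter fsbig_seq ?filter_uniq ?index_enum_uniq//.
rewrite -measure_fsbig//; last by apply: sub_trivIset tC.
congr (mu _); rewrite -fsbig_seq ?filter_uniq ?index_enum_uniq// -bigcup_seq.
by apply: eq_bigcupl; split => k /=; rewrite mem_filter mem_index_enum andbT.
Qed.

Lemma ae_eq_measure d (T : measurableType d) (R : realType)
    (mu : {measure set T -> \bar R}) (A B : set T) :
  measurable A -> measurable B -> {ae mu, forall t, A t <-> B t} -> mu A = mu B.
Proof.
have le (A' B' : set T) : measurable A' -> measurable B' ->
    {ae mu, forall t, A' t <-> B' t} -> (mu A' <= mu B')%E.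
  move=> mA mB [N [mN N0 subN]].
  have mBN : measurable (B' `|` N) by exact: measurableU.
  apply: (@le_trans _ _ (mu (B' `|` N))).
    apply: le_measure; rewrite ?inE// => t At.
    have [Bt|NBt] := pselect (B' t); [by left|right].
    by apply: subN => -[/(_ At)].
  apply: (le_trans (measureU2 mu mB mN)).
  have N_le0 : (mu N <= 0)%E by rewrite N0.
  by rewrite -[leRHS]adde0; exact: leeD.
move=> mA mB AB; apply/eqP; rewrite eq_le !le//.
by apply: filterS AB => t [? ?]; split.
Qed.

(** The [C k] are the atoms of the family: for each subset of indices, the points that lie in
    exactly those [B i]. *)
Lemma disjoint_refinement (R : realType) d (E : measurableType d)
    (mu : {measure set E -> \bar R}) (I : finType) (B : I -> set E) :
  (forall i, finite_measurable mu (B i)) ->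
  exists K (C : 'I_K -> set E) (inc : 'I_K -> I -> bool),
    [/\ (0 < K)%N, forall k, finite_measurable mu (C k), trivIset setT C &
        forall i, B i = \bigcup_(k in [set k | inc k i]) C k].
Proof.
move=> fB.
pose S (k : 'I_#|{set I}|) : {set I} := enum_val k.
(* The atom of the empty subset is the complement of all [B i] and may have infinite measure, so it
   is replaced by the empty set. *)
pose C k : set E := if S k == finset.set0 then set0
  else \bigcap_(i in setT) (if i \in S k then B i else ~` B i).
have CP k e : S k != finset.set0 ->
    C k e <-> forall i, (i \in S k) = `[< B i e >].
  move=> S0; rewrite /C (negbTE S0); split => [Ce i|Ce i _].
    have := Ce i Logic.I; case: ifP => _ H; apply/esym; first exact/asboolP.
    exact/asboolPn.
  by rewrite Ce; case: asboolP.
exists #|{set I}|, C, (fun k i => i \in S k); split.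
- by apply/card_gt0P; exists finset.set0.
- move=> k; rewrite /C; case: eqP => [_|/eqP S0].
    by split; [exact: measurable0|rewrite measure0 ltry].
  have mC : measurable (\bigcap_(i in setT) (if i \in S k then B i else ~` B i)).
    apply: fin_bigcap_measurable => // i _; have [mB _] := fB i.
    by case: ifP => // _; exact: measurableC.
  split => //; have /finset.set0Pn [i iS] := S0; have [mB Boo] := fB i.
  apply: le_lt_trans Boo; apply: le_measure; rewrite ?inE// => e /(_ i Logic.I).
  by rewrite iS.
- move=> k l _ _ [e []].
  have [Sk0|Sk0] := eqVneq (S k) finset.set0; first by rewrite {1}/C Sk0 eqxx.
  have [Sl0|Sl0] := eqVneq (S l) finset.set0.
    by rewrite {2}/C Sl0 eqxx.
  move=> /(CP _ _ Sk0) ek /(CP _ _ Sl0) el.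
  by apply: enum_val_inj; apply/finset.setP => i; rewrite -/(S k) -/(S l) ek el.
- move=> i; apply/seteqP; split => [e Be|e [k /= iS]].
    pose k : 'I_#|{set I}| := enum_rank [set j | `[< B j e >]]%SET.
    have Sk : S k = [set j | `[< B j e >]]%SET by rewrite /S /k enum_rankK.
    have ik : i \in S k by rewrite Sk finset.in_set; exact/asboolP.
    exists k => //; apply/CP; first by apply/finset.set0Pn; exists i.
    by move=> j; rewrite Sk finset.in_set.
  have S0 : S k != finset.set0 by apply/finset.set0Pn; exists i.
  by move=> /(CP _ _ S0) /(_ i); rewrite iS => /esym/asboolP.
Qed.

Lemma add_unit_inj M (j : 'I_M) : injective (fun v => add_unit v j).
Proof.
move=> u v /ffunP uv; apply/ffunP => i.
by have := uv i; rewrite !ffunE => /addIn.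
Qed.

Section poisson_counts.
Context {R : realType} {d d' : measure_display}
  {Omega : measurableType d} {E : measurableType d'}.
Variables (P : probability Omega R) (mu : {measure set E -> \bar R})
  (N : R.-ker Omega ~> E).
Hypothesis hN : poisson_random_measure P mu N.

Let pois (B : set E) (k : nat) : R :=
  expR (- fine (mu B)) * fine (mu B) ^+ k / k`!%:R.

Let measurable_N_eq B (x : \bar R) : measurable B ->
  measurable [set w | N w B = x].
Proof.
move=> mB; have := measurable_kernel N B mB measurableT _ (emeasurable_set1 x).
by rewrite setTI.
Qed.

Let pois_succ B k : pois B k * fine (mu B) = k.+1%:R * pois B k.+1.
Proof.
rewrite /pois factS natrM exprS.
have k0 : k`!%:R != 0 :> R by rewrite pnatr_eq0 -lt0n fact_gt0.
have k1 : k.+1%:R != 0 :> R by rewrite pnatr_eq0.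
by field; rewrite k0 addrC natr1 k1.
Qed.

(** The disjoint events that [N(B) = k] have total probability [1], as the Poisson weights sum to
    [1]. At rate [0] the event [N(B) = 0] alone has probability [1]. *)
Lemma prm_ae_finite B : finite_measurable mu B ->
  {ae P, forall w, exists k : nat, N w B = (k%:R)%:E}.
Proof.
move=> [mB Boo].
pose A k := [set w | N w B = (k%:R)%:E].
have mA k : measurable (A k) by exact: measurable_N_eq.
have mU : measurable (\bigcup_k A k) by exact: bigcup_measurable.
have tA : trivIset setT A.
  move=> i j _ _ [w [wi wj]]; move: wi; rewrite /A /= wj => -[/eqP].
  by rewrite eqr_nat => /eqP.
suff PU : P (\bigcup_k A k) = 1%E.
  exists (~` (\bigcup_k A k)); split; first exact: measurableC.
    by rewrite probability_setC// PU subee.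
  by apply: subsetC => w [k _ wk]; exists k.
have [mu0|mu0] := eqVneq (fine (mu B)) 0.
  apply/eqP; rewrite eq_le probability_le1//=.
  have <- : P (A 0%N) = 1%E.
    by rewrite (prm_finite hN mB Boo) mu0 oppr0 expR0 expr0 fact0 mulr1 divr1.
  by apply: le_measure; rewrite ?inE//; exact: bigcup_sup.
have {}mu0 : 0 < fine (mu B) by rewrite lt0r mu0 fine_ge0.
rewrite measure_semi_bigcup// nneseries_esumT//.
have := @probability_setT _ _ _ (poisson_prob (fine (mu B)) 0%N).
rewrite /= /poisson_prob mu0 => <-; apply: eq_esum => k _.
by rewrite (prm_finite hN mB Boo) /poisson_pmf mu0 -mulrA [X in X%:E]mulrC.
Qed.

Variables (K : nat) (C : 'I_K -> set E).
Hypothesis fC : forall k, finite_measurable mu (C k).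

Lemma ae_counts : {ae P, forall w, forall k,
  N w (C k) = ((counts N C w k)%:R)%:E}.
Proof.
apply: filter_forall => k; apply: filterS (prm_ae_finite (fC k)) => w [n wn].
by rewrite ffunE wn /= truncn_nat.
Qed.

Lemma measurable_counts v : measurable (counts N C @^-1` [set v]).
Proof.
have -> : counts N C @^-1` [set v] = \bigcap_(k in setT)
    [set w | Num.truncn (fine (N w (C k))) = v k].
  apply/seteqP; split => [w /= <- k _|w wv]; first by rewrite /= ffunE.
  by apply/ffunP => k; rewrite ffunE; exact: wv.
apply: fin_bigcap_measurable => // k _; have [mC _] := fC k.
(* [fine] sends [+oo] to [0], so an infinite count is read as [0]. *)
have -> : [set w | Num.truncn (fine (N w (C k))) = v k] =
    [set w | N w (C k) = ((v k)%:R)%:E] `|`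
    (if v k == 0%N then [set w | N w (C k) = +oo%E] else set0).
  apply/seteqP; split => w /=.
    case: (prm_integer hN w mC) => [Nw|[n Nw]]; rewrite Nw /=; last first.
      by rewrite truncn_nat => ->; left.
    by rewrite truncn0 => <-; right.
  case: ifP => [/eqP ->|_] [|//] => ->; by rewrite ?truncn_nat// truncn0.
apply: measurableU; first exact: measurable_N_eq.
by case: ifP => _; [exact: measurable_N_eq|exact: measurable0].
Qed.

Hypothesis tC : trivIset setT C.

Lemma prob_counts v : fine (P (counts N C @^-1` [set v])) =
  \prod_(k < K) (expR (- fine (mu (C k))) * fine (mu (C k)) ^+ v k / (v k)`!%:R).
Proof.
have mC k : measurable (C k) by case: (fC k).
pose A k : set (\bar R) := [set ((v k)%:R)%:E].
have mA k : measurable (A k) by exact: emeasurable_set1.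
transitivity (fine (P [set w | forall k, A k (N w (C k))])).
  congr fine; apply: ae_eq_measure; first exact: measurable_counts.
    have -> : [set w | forall k, A k (N w (C k))] =
        \bigcap_(k in setT) [set w | N w (C k) = ((v k)%:R)%:E].
      by apply/seteqP; split => w H k; [move=> _; exact: H|exact: (H k Logic.I)].
    by apply: fin_bigcap_measurable => // k _; exact: measurable_N_eq.
  apply: filterS ae_counts => w wC; split => [/= wv k|H].
    by rewrite /A -wv; exact: wC.
  apply/ffunP => k; have := H k; rewrite /A /= wC => -[cv].
  by apply/eqP; rewrite -(eqr_nat R) cv.
rewrite (prm_independent hN mC tC mA); apply: eq_bigr => k _.
by have [_ Coo] := fC k; rewrite (prm_finite hN (mC k) Coo).
Qed.

(** By independence both probabilities are products of Poisson weights; only the factor at [j]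
    changes, and there [pois_succ] applies. *)
Lemma counts_mecke j v :
  fine (P (counts N C @^-1` [set v])) * fine (mu (C j)) =
  (add_unit v j j)%:R * fine (P (counts N C @^-1` [set add_unit v j])).
Proof.
rewrite !prob_counts (bigD1 j)//= [in RHS](bigD1 j)//= ffunE eqxx addn1.
rewrite mulrAC [X in X * _ = _](pois_succ (C j)) -mulrA; congr (_ * (_ * _)).
by apply: eq_bigr => k kj; rewrite ffunE (negbTE kj) addn0.
Qed.

End poisson_counts.

(** * The Malliavin derivative *)

Section malliavin_derivative.
Context {R : realType} {d d' : measure_display}
  {Omega : measurableType d} {E : measurableType d'}.
Variables (P : probability Omega R) (mu : {measure set E -> \bar R})
  (N : R.-ker Omega ~> E).
Hypothesis hN : poisson_random_measure P mu N.

(** Additivity of the measure [N w]; one null set serves all [Q] at once. *)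
Lemma ae_counts_bigcup K (C : 'I_K -> set E) :
  (forall k, finite_measurable mu (C k)) -> trivIset setT C ->
  {ae P, forall w, forall Q : pred 'I_K,
    N w (\bigcup_(k in [set k | Q k]) C k) =
    ((\sum_(k < K | Q k) counts N C w k)%:R)%:E}.
Proof.
move=> fC tC; apply: filterS (ae_counts hN fC) => w Nw Q.
rewrite (measure_bigcup_ord (N w)) => [|k|//]; last by case: (fC k).
by rewrite natr_sum -sumEFin; apply: eq_bigr => k _; rewrite Nw.
Qed.

(** The [xget] in [malliavin] needs one representation over disjoint sets. The sets of all the [G i]
    are refined together, and each original count is a sum of refined counts. *)
Lemma is_malliavin_derivative_malliavin (X : normedModType R) (F : Omega -> X) :
  vector_cylindrical P mu N F ->
  is_malliavin_derivative P mu N F (malliavin P mu N F).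
Proof.
move=> [n [G [x [n0 cG FG]]]]; apply: xgetPex.
have /choice [r hr] i : exists r : {M : nat &
    (({ffun 'I_M -> nat} -> R) * ('I_M -> set E))%type},
    (forall m, finite_measurable mu ((tagged r).2 m)) /\
    {ae P, forall w, G i w = (tagged r).1 (counts N (tagged r).2 w)}.
  have [M [f [B [_ fB GfB]]]] := cG i.
  by exists (existT _ M (f, B)).
(* Each [G i] has its own number of sets; [I] indexes all of them. *)
pose I : finType := {i : 'I_n & 'I_(tag (r i))}.
pose idx i (j : 'I_(tag (r i))) : I := Tagged (fun i => 'I_(tag (r i))) j.
pose B (u : I) : set E := (tagged (r (tag u))).2 (tagged u).
have fB u : finite_measurable mu (B u) by exact: (hr (tag u)).1.
have [K [C [inc [K0 fC tC BC]]]] := disjoint_refinement fB.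
pose f i (v : {ffun 'I_K -> nat}) := (tagged (r i)).1
  [ffun m => \sum_(k < K | inc k (idx i m)) v k]%N.
exists (malliavin_formula N f C x); exists n, K, f, C, x; split => //.
have Gr : {ae P, forall w, forall i, G i w = (tagged (r i)).1
    (counts N (tagged (r i)).2 w)}.
  by apply: filter_forall => i; case: (hr i).
apply: filterS3 FG Gr (ae_counts_bigcup fC tC) => w -> Gw Nw.
apply: eq_bigr => i _; rewrite Gw; congr (_ *: _); congr (_ _).
apply/ffunP => m; rewrite !ffunE.
have -> : (tagged (r i)).2 m = B (idx i m) by [].
by rewrite BC Nw truncn_nat.
Qed.

(** For fixed [w] the integrand is a finite sum of indicators of the [A]&[B m] times vectors, the
    increments of [g]. *)
Lemma is_bochner_integral_malliavin (X : normedModType R) n M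
    (f : 'I_n -> {ffun 'I_M -> nat} -> R) (B : 'I_M -> set E) (x : 'I_n -> X)
    (A : set E) (w : Omega) :
  measurable A -> (forall m, finite_measurable mu (B m)) ->
  let g v := \sum_(i < n) f i v *: x i in
  is_bochner_integral mu
    (fun e => (\1_A e : R) *: malliavin_formula N f B x w e)
    (\sum_(m < M) fine (mu (A `&` B m)) *:
      (g (add_unit (counts N B w) m) - g (counts N B w))).
Proof.
move=> mA fB g.
have ind m : is_bochner_integral mu
    (fun e => (\1_(A `&` B m) e : R) *:
      (g (add_unit (counts N B w) m) - g (counts N B w)))
    (fine (mu (A `&` B m)) *:
      (g (add_unit (counts N B w) m) - g (counts N B w))).
  have [mB Boo] := fB m; have mAB : measurable (A `&` B m) by exact: measurableI.
  apply: is_bochner_integral_indic => //.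
  by apply: le_lt_trans Boo; apply: le_measure; rewrite ?inE//; exact: subIsetr.
have := is_bochner_integral_sum (index_enum 'I_M) (fun m (_ : true) => ind m).
congr is_bochner_integral; apply/funext => e.
rewrite /malliavin_formula exchange_big scaler_sumr; apply: eq_bigr => m _.
rewrite /g -sumrB !scaler_sumr; apply: eq_bigr => i _.
rewrite -scalerBl !scalerA indicI /=; congr (_ *: _).
exact: mulrAC.
Qed.

End malliavin_derivative.

Theorem proposition5p5 (R : realType) (d d' : measure_display)
  (Omega : measurableType d) (E : measurableType d')
  (P : probability Omega R) (mu : {sigma_finite_measure set E -> \bar R})
  (N : R.-ker Omega ~> E) (hN : poisson_random_measure P mu N)
  (X : completeNormedModType R)
  (F : Omega -> X) (hF : vector_cylindrical P mu N F)
  (B : set E) (hB : finite_measurable mu B) :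
  let int_DF := fun w : Omega =>
    bochner_integral mu (fun e => (\1_B e : R) *: malliavin P mu N F w e) in
  let NF := fun w : Omega => compensated mu N B w *: F w in
  (bochner_integrable P F -> bochner_integrable P NF ->
     bochner_integrable P int_DF) /\
  (bochner_integrable P int_DF -> bochner_integrable P NF ->
     bochner_integral P int_DF = bochner_integral P NF).
Proof.
move=> int_DF NF.
have [n [M [f [A [x [_ fA tA FfA DFE]]]]]] :=
  is_malliavin_derivative_malliavin hN hF.
pose g v := \sum_(i < n) f i v *: x i.
(* The sets [A m] behind the chosen derivative are unrelated to [B]; adjoining [B] as [None] makes
   the refinement resolve both. *)
pose sets (i : option 'I_M) := if i is Some m then A m else B.
have fsets i : finite_measurable mu (sets i) by case: i.
have [K [C [inc [_ fC tC setsC]]]] := disjoint_refinement fsets.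
have mC k : measurable (C k) by case: (fC k).
have Coo k : mu (C k) \is a fin_num by rewrite ge0_fin_numE//; case: (fC k).
pose Z := counts N C.
have mZ t : measurable (Z @^-1` [set t]) by exact: (measurable_counts hN fC).
pose D : pred 'I_K := fun k => inc k None.
pose sigma k v := add_unit v k : {ffun 'I_K -> nat}.
pose c k (v : {ffun 'I_K -> nat}) := v k.
pose m k : R := fine (mu (C k)).
have m0 k : 0 <= m k by exact: fine_ge0.
have c_sigma k v : c k v != 0%N -> exists v', v = sigma k v'.
  rewrite /c -lt0n => vk; exists [ffun j => (v j - (j == k))%N].
  apply/ffunP => j; rewrite !ffunE subnK//.
  by case: eqP => [->|].
have n_sigma k v : D k ->
    (\sum_(j | D j) c j (sigma k v) = (\sum_(j | D j) c j v).+1)%N.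
  move=> Dk; rewrite (bigD1 k)//= [in RHS](bigD1 k)//= /c ffunE eqxx addn1 addSn.
  congr (_ + _).+1; apply: eq_bigr => j /andP[_ jk].
  by rewrite ffunE (negbTE jk) addn0.
have mecke k v := counts_mecke hN fC tC k v.
(* [rest v] recovers the counts of the [A m] from those of the refinement. *)
pose rest (v : {ffun 'I_K -> nat}) : {ffun 'I_M -> nat} :=
  [ffun i => \sum_(k | inc k (Some i)) v k]%N.
pose h v := g (rest v).
pose G v := \sum_(k | D k) m k *: (h (sigma k v) - h v).
pose H v := ((\sum_(k | D k) c k v)%:R - \sum_(k | D k) m k) *: h v.
have restE : {ae P, forall w, counts N A w = rest (Z w)}.
  apply: filterS (ae_counts_bigcup hN fC tC) => w Nw; apply/ffunP => i.
  by rewrite !ffunE [A i](setsC (Some i)) Nw truncn_nat.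
have Fh : {ae P, forall w, F w = h (Z w)}.
  by apply: filterS2 FfA restE => w -> ->.
have lamE : fine (mu B) = \sum_(k | D k) m k.
  rewrite sum_fine; last by move=> k _; exact: Coo.
  rewrite -(measure_bigcup_ord mu D mC tC); congr (fine (mu _)).
  exact: (setsC None).
have NFH : {ae P, forall w, NF w = H (Z w)}.
  apply: filterS2 Fh (ae_counts_bigcup hN fC tC) => w Fw Nw.
  by rewrite /NF Fw /compensated [X in N w X](setsC None) Nw lamE.
(* The [A m] are disjoint, so a nonempty atom lies in at most one of them; an empty one may be
   listed under several. *)
have inc_uniq k i j : inc k (Some i) -> inc k (Some j) -> C k !=set0 -> i = j.
  move=> ki kj [e Ce]; apply: tA => //; exists e; split.
    by rewrite -[A i]/(sets (Some i)) setsC; exists k.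
  by rewrite -[A j]/(sets (Some j)) setsC; exists k.
(* Split each [B]&[A i] into atoms and exchange the sums. A point added to an atom inside [B] is a
   point added to the one [A i] containing that atom, or leaves [h] unchanged if there is none. *)
have GE v : G v = \sum_(i < M) fine (mu (B `&` A i)) *:
    (g (add_unit (rest v) i) - g (rest v)).
  have muBA i : fine (mu (B `&` A i)) =
      \sum_(k | D k && inc k (Some i)) m k.
    rewrite sum_fine; last by move=> k _; exact: Coo.
    rewrite -(measure_bigcup_ord mu (fun k => D k && inc k (Some i)) mC tC).
    congr (fine (mu _)); rewrite [B](setsC None) [A i](setsC (Some i)).
    apply/seteqP.
    split => [e [[k /= kB ke] [l /= lA le]]|e [k /= /andP[kB kA] ke]].
      have kl : k = l by apply: tC => //; exists e.
      by exists k => //=; rewrite /D kB kl lA.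
    by split; exists k.
  under [RHS]eq_bigr => i _ do rewrite muBA scaler_suml.
  rewrite (exchange_big_dep D)/=; last by move=> i k _ /andP[].
  apply: eq_bigr => k Dk; under eq_bigl => i do rewrite Dk.
  have [C0|/set0P C0] := eqVneq (C k) set0.
    by rewrite /m C0 measure0 scale0r big1// => i _; rewrite scale0r.
  have rest_sigma : rest (sigma k v) = [ffun i => rest v i + inc k (Some i)]%N.
    apply/ffunP => i; rewrite !ffunE.
    under eq_bigr do rewrite ffunE.
    rewrite big_split/=; congr (_ + _)%N.
    case: (boolP (inc k (Some i))) => ki.
      rewrite (bigD1 k)//= eqxx big1// => j /andP[_ /negbTE ->//].
    by rewrite big1// => j ij; case: eqP => // jk; rewrite -jk ij in ki.
  case: (pickP (fun i => inc k (Some i))) => [i ki|k0].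
    rewrite (bigD1 i)//= big1 ?addr0; last first.
      by move=> j /andP[kj]; rewrite (inc_uniq _ _ _ kj ki C0) eqxx.
    congr (_ *: (g _ - _)); rewrite rest_sigma; apply/ffunP => j.
    rewrite !ffunE; congr (_ + _)%N; case: eqP => [->|ji]; first by rewrite ki.
    by case: (boolP (inc k _)) => // kj; case: ji; exact: inc_uniq kj ki C0.
  rewrite big_pred0// /h rest_sigma (_ : [ffun _ => _] = rest v).
    by rewrite subrr scaler0.
  by apply/ffunP => i; rewrite ffunE k0 addn0.
have DFG : {ae P, forall w, int_DF w = G (Z w)}.
  apply: filterS restE => w cw; rewrite /int_DF DFE GE.
  have [mB _] := hB.
  by rewrite (bochner_integralE (is_bochner_integral_malliavin N f x w mB fA)) cw.
have ae_sym (f1 f2 : Omega -> X) : {ae P, forall w, f1 w = f2 w} ->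
    {ae P, forall w, f2 w = f1 w} by apply: filterS.
have main := bochner_mecke_family mZ (@add_unit_inj K) m0 c_sigma mecke
  (D := D) (h := h).
have Fi := norm_integrableP mZ Fh; have NFi := norm_integrableP mZ NFH.
have DFi := norm_integrableP mZ DFG.
(* The first half gets integrability of [mu(B) h] from that of [F]; the second recovers it from the
   derivative and the compensated product. *)
split=> [/Fi hi /NFi Hi|/DFi Gi /NFi Hi].
  have [v [Gv _]] := main (norm_integrableZ mZ _ hi) Hi.
  by exists v; apply: is_bochner_integral_ae Gv; exact: ae_sym.
have hi := norm_integrable_mecke_family mZ (@add_unit_inj K) m0 mecke n_sigma
  Gi Hi.
have [v [Gv Hv]] := main hi Hi.
rewrite (bochner_integralE (is_bochner_integral_ae (ae_sym _ _ DFG) Gv)).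
by rewrite (bochner_integralE (is_bochner_integral_ae (ae_sym _ _ NFH) Hv)).
Qed.
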